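(* Let $N\ge2$ and set $a_{2k-1}=(x_ky_k)^{-1}$, $a_{2k}=(y_kx_{k+1})^{-1}$ in $A_q$. Define $$U=\Bigl(1-a_1\lambda^{-1}\bigl(1-a_2\lambda^{-1}(\cdots(1-a_{2N-3}\lambda^{-1}(1-a_{2N-2}\lambda^{-1})^{-1})^{-1}\cdots)^{-1}\bigr)^{-1}\Bigr)^{-1},$$ $$V=\Bigl(1-a_2\lambda^{-1}\bigl(1-a_3\lambda^{-1}(\cdots(1-a_{2N-2}\lambda^{-1}(1-a_{2N-1}\lambda^{-1})^{-1})^{-1}\cdots)^{-1}\bigr)^{-1}\Bigr)^{-1}.$$ Then $U$ and $V$ are well defined and belong to $S_1$, and $$\ln_qU+\ln_qV\equiv\sum_{p=1}^{\infty}\frac{\psi_p}{[p]}\lambda^{-p}\pmod{\lambda^{-(2N-1)}},$$ i.e. the coefficients of $\lambda^{-p}$ on both sides agree for all $p\le 2N-2$.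
   Context: Let $q$ be an indeterminate. $A_q$ is the associative unital algebra over $\mathbb{C}[q,q^{-1}]$ generated by $x_i^{\pm1},y_i^{\pm1}$ ($i\in\mathbb{Z}$) with relations: for $i<j$, $x_ix_j=q\,x_jx_i$, $y_iy_j=q\,y_jy_i$, $x_iy_j=q^{-1}y_jx_i$, $y_ix_j=q^{-1}x_jy_i$; and $x_iy_i=q^{-1}y_ix_i$ for all $i$. It is an integral domain, free over $\mathbb{C}[q,q^{-1}]$ with basis the ordered monomials $\prod_{i}x_i^{\alpha_i}y_i^{\beta_i}$ (finitely supported integer exponents), so $A_q\subset\mathbb{C}(q)\otimes_{\mathbb{C}[q,q^{-1}]}A_q$. Let $T^{1/2}$ be the algebra automorphism of $A_q$ with $T^{1/2}(x_i)=y_i$, $T^{1/2}(y_i)=x_{i+1}$. $S$ is the ring of formal power series in a central indeterminate $\lambda^{-1}$ with coefficients in $\mathbb{C}(q)\otimes_{\mathbb{C}[q,q^{-1}]}A_q$, with its $\lambda^{-1}$-adic valuation $v$ ($v(\lambda^{-1})=1$). $S_1=\{f\in S: v(f-1)\ge1\}$; each $f\in S_1$ is invertible with inverse $\sum_k(1-f)^k\in S_1$. Define $\ln_q:S_1\to S$ by $\ln_q(f)=\sum_{p=1}^\infty\frac1{[p]}(1-f^{-1})^p$. $q$-numbers: $[m]=\frac{q^m-1}{q-1}$ and $[m]!=\prod_{k=1}^m[k]$ for $m\in\mathbb{N}=\{0,1,2,\dots\}$. For $(m,p)\in\mathbb{Z}^2$, $\left[\begin{smallmatrix}m\\ p\end{smallmatrix}\right]$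 equals $1$ if $p=0$; $0$ if $p<0$ or $p>\max(0,m)$; and $\frac{[m]!}{[p]!\,[m-p]!}$ if $0\le p\le m$. For integers $b_1,\dots,b_M$, $F_q(b_1,\dots,b_M)=\prod_{i=1}^{M-1}\left[\begin{smallmatrix}b_i+b_{i+1}-1\\ b_{i+1}\end{smallmatrix}\right]$. For $n\ge1$ choose any integer $N'$ with $n\le 2(N'-1)$, let $I_n$ be the set of $(\alpha_1,\dots,\alpha_{2N'-2})\in\mathbb{N}^{2N'-2}$ with $\alpha_1\ge1$ and $\sum\alpha_i=n$, and put $$A_n=\sum_{\underline\alpha\in I_n}\frac{[n]}{[\alpha_1]}F_q(\alpha_1,\dots,\alpha_{2N'-2})\,(x_1y_1)^{-\alpha_1}(y_1x_2)^{-\alpha_2}\cdots(x_{N'-1}y_{N'-1})^{-\alpha_{2N'-3}}(y_{N'-1}x_{N'})^{-\alpha_{2N'-2}},$$ $B_n=T^{1/2}(A_n)$, $\psi_n=A_n+B_n$. The coefficients lie in $\mathbb{Z}[q]$, and $A_n,\psi_n$ do not depend on the choice of $N'$. *)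

(* Defs.v *)
From HB Require Import structures.
From mathcomp Require Import all_boot all_order all_algebra.
From mathcomp Require Import boolp reals complex ring lra zify.

Set Implicit Arguments.
Unset Strict Implicit.
Unset Printing Implicit Defensive.
Import Order.TTheory GRing.Theory Num.Theory.
Local Open Scope ring_scope.

(* Over C = R[i], [ratq C] is the field C(q), with the indeterminate [qv C]. *)
Definition ratq (F : fieldType) : fieldType := {fraction {poly F}}.
Definition qv (F : fieldType) : ratq F := FracField.tofrac ('X : {poly F}).

Lemma qv_neq0 (F : fieldType) : qv F != 0.
Proof. by rewrite /qv tofrac_eq0 polyX_eq0. Qed.

(* The algebra C(q) (x) A_q, by generators and relations: words in x_i, y_i and
   their formal inverses, modulo the least C(q)-algebra congruence containing
   the defining relations. *)
Inductive gen := GX of int | GY of int.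

Inductive qterm (K : Type) :=
  | TC of K
  | TG of gen
  | TV of gen
  | TN of qterm K
  | TD of qterm K & qterm K
  | TM of qterm K & qterm K.
Arguments TG {K}. Arguments TV {K}.

Section Presentation.
Variable F : fieldType.
Local Notation K := (ratq F).
Local Notation q := (qv F).
Local Notation term := (qterm K).
Local Notation X i := (TG (GX i) : term).
Local Notation Y i := (TG (GY i) : term).

Inductive qrel : term -> term -> Prop :=
  | q_refl t : qrel t t
  | q_sym t u : qrel t u -> qrel u t
  | q_trans t u v : qrel t u -> qrel u v -> qrel t v
  | q_opp t t' : qrel t t' -> qrel (TN t) (TN t')
  | q_add t t' u u' : qrel t t' -> qrel u u' -> qrel (TD t u) (TD t' u')
  | q_mul t t' u u' : qrel t t' -> qrel u u' -> qrel (TM t u) (TM t' u')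
  | q_addA t u v : qrel (TD t (TD u v)) (TD (TD t u) v)
  | q_addC t u : qrel (TD t u) (TD u t)
  | q_add0 t : qrel (TD (TC 0) t) t
  | q_addN t : qrel (TD (TN t) t) (TC 0)
  | q_mulA t u v : qrel (TM t (TM u v)) (TM (TM t u) v)
  | q_mul1 t : qrel (TM (TC 1) t) t
  | q_mulDl t u v : qrel (TM (TD t u) v) (TD (TM t v) (TM u v))
  | q_mulDr t u v : qrel (TM t (TD u v)) (TD (TM t u) (TM t v))
  | q_constD a b : qrel (TC (a + b)) (TD (TC a) (TC b))
  | q_constM a b : qrel (TC (a * b)) (TM (TC a) (TC b))
  | q_central a t : qrel (TM (TC a) t) (TM t (TC a))
  | q_genV g : qrel (TM (TG g) (TV g)) (TC 1)
  | q_Vgen g : qrel (TM (TV g) (TG g)) (TC 1)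
  | q_xx (i j : int) : i < j ->
      qrel (TM (X i) (X j)) (TM (TC q) (TM (X j) (X i)))
  | q_yy (i j : int) : i < j ->
      qrel (TM (Y i) (Y j)) (TM (TC q) (TM (Y j) (Y i)))
  | q_xy (i j : int) : i < j ->
      qrel (TM (X i) (Y j)) (TM (TC q^-1) (TM (Y j) (X i)))
  | q_yx (i j : int) : i < j ->
      qrel (TM (Y i) (X j)) (TM (TC q^-1) (TM (X j) (Y i)))
  | q_xyi (i : int) :
      qrel (TM (X i) (Y i)) (TM (TC q^-1) (TM (Y i) (X i))).

HB.instance Definition _ := gen_eqMixin term.
HB.instance Definition _ := gen_choiceMixin term.

Definition qrelb (t u : term) : bool := `[< qrel t u >].

Lemma qrelb_refl : reflexive qrelb.
Proof. by move=> t; apply/asboolP; exact: q_refl. Qed.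
Lemma qrelb_sym : symmetric qrelb.
Proof. by move=> t u; apply/asboolP/asboolP; exact: q_sym. Qed.
Lemma qrelb_trans : transitive qrelb.
Proof.
by move=> u t v /asboolP tu /asboolP uv; apply/asboolP; exact: q_trans uv.
Qed.

Definition qrel_equiv : equiv_rel term :=
  EquivRel qrelb qrelb_refl qrelb_sym qrelb_trans.

End Presentation.

(* [qtorus C] is C(q) (x) A_q; A_q is its C[q,q^-1]-subalgebra generated by the
   x_i^{+-1}, y_i^{+-1}. *)
Definition qtorus (F : fieldType) : Type := {eq_quot (qrel_equiv F)}%qT.

(* The two-sided inverse, when there is one (decided classically). *)
Section ClassicalUnits.
Variable A : nzRingType.
Implicit Types x y : A.

Definition cl_unit : pred A :=
  fun x => `[< exists y, y * x = 1 /\ x * y = 1 >].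
Definition cl_inv x : A :=
  match pselect (exists y, y * x = 1 /\ x * y = 1) with
  | left ex => sval (cid ex)
  | right _ => x
  end.

Lemma cl_mulVr : {in cl_unit, left_inverse 1 cl_inv *%R}.
Proof.
move=> x /asboolP ex; rewrite /cl_inv; case: pselect => // ex'.
by case: cid => y [].
Qed.
Lemma cl_divrr : {in cl_unit, right_inverse 1 cl_inv *%R}.
Proof.
move=> x /asboolP ex; rewrite /cl_inv; case: pselect => // ex'.
by case: cid => y [].
Qed.
Lemma cl_unitP x y : y * x = 1 /\ x * y = 1 -> cl_unit x.
Proof. by move=> xy; apply/asboolP; exists y. Qed.
Lemma cl_inv_out : {in [predC cl_unit], cl_inv =1 id}.
Proof.
move=> x /= /asboolP nex; rewrite /cl_inv; case: pselect => // ex; by case: nex.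
Qed.
End ClassicalUnits.

Section QTorus.
Variable F : fieldType.
Local Notation K := (ratq F).
Local Notation q := (qv F).
Local Notation term := (qterm K).
Local Notation T := (qtorus F).

HB.instance Definition _ := Choice.on T.

Definition qt_class (t : term) : T := (\pi t)%qT.
Definition qt_repr (u : T) : term := repr u.

Lemma qt_reprK u : qt_class (qt_repr u) = u.
Proof. by rewrite /qt_class /qt_repr reprK. Qed.

Lemma qt_classP t u : qt_class t = qt_class u <-> qrel t u.
Proof.
split=> [tu|tu]; last by apply/eqmodP/asboolP.
by have /eqmodP/asboolP := tu.
Qed.

Lemma qt_repr_class t : qrel (qt_repr (qt_class t)) t.
Proof. by apply/qt_classP; rewrite qt_reprK. Qed.

Lemma qt_ind (P : T -> Prop) : (forall t, P (qt_class t)) -> forall u, P u.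
Proof. by move=> Pc u; rewrite -(qt_reprK u). Qed.

Definition qt_opp (u : T) := qt_class (TN (qt_repr u)).
Definition qt_add (u v : T) := qt_class (TD (qt_repr u) (qt_repr v)).
Definition qt_mul (u v : T) := qt_class (TM (qt_repr u) (qt_repr v)).
Definition qt_scale (a : K) (u : T) := qt_class (TM (TC a) (qt_repr u)).

Lemma qt_oppE t : qt_opp (qt_class t) = qt_class (TN t).
Proof. apply/qt_classP/q_opp; exact: qt_repr_class. Qed.
Lemma qt_addE t u : qt_add (qt_class t) (qt_class u) = qt_class (TD t u).
Proof. apply/qt_classP/q_add; exact: qt_repr_class. Qed.
Lemma qt_mulE t u : qt_mul (qt_class t) (qt_class u) = qt_class (TM t u).
Proof. apply/qt_classP/q_mul; exact: qt_repr_class. Qed.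
Lemma qt_scaleE a t : qt_scale a (qt_class t) = qt_class (TM (TC a) t).
Proof. apply/qt_classP/q_mul; [exact: q_refl|exact: qt_repr_class]. Qed.

Let qE := (qt_oppE, qt_addE, qt_mulE, qt_scaleE).

Fact qt_addA : associative qt_add.
Proof.
elim/qt_ind=> t; elim/qt_ind=> u; elim/qt_ind=> v; rewrite !qE.
exact/qt_classP/q_addA.
Qed.
Fact qt_addC : commutative qt_add.
Proof. elim/qt_ind=> t; elim/qt_ind=> u; rewrite !qE; exact/qt_classP/q_addC. Qed.
Fact qt_add0 : left_id (qt_class (TC 0)) qt_add.
Proof. elim/qt_ind=> t; rewrite !qE; exact/qt_classP/q_add0. Qed.
Fact qt_addN : left_inverse (qt_class (TC 0)) qt_opp qt_add.
Proof. elim/qt_ind=> t; rewrite !qE; exact/qt_classP/q_addN. Qed.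

HB.instance Definition _ := GRing.isZmodule.Build T
  qt_addA qt_addC qt_add0 qt_addN.

Fact qt_mulA : associative qt_mul.
Proof.
elim/qt_ind=> t; elim/qt_ind=> u; elim/qt_ind=> v; rewrite !qE.
exact/qt_classP/q_mulA.
Qed.
Fact qt_mul1 : left_id (qt_class (TC 1)) qt_mul.
Proof. elim/qt_ind=> t; rewrite !qE; exact/qt_classP/q_mul1. Qed.
Fact qt_mulr1 : right_id (qt_class (TC 1)) qt_mul.
Proof.
elim/qt_ind=> t; rewrite !qE; apply/qt_classP.
by apply: q_trans (q_mul1 _); apply: q_sym; apply: q_central.
Qed.
Fact qt_mulDl : left_distributive qt_mul +%R.
Proof.
elim/qt_ind=> t; elim/qt_ind=> u; elim/qt_ind=> v.
by rewrite /GRing.add /= !qE; apply/qt_classP/q_mulDl.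
Qed.
Fact qt_mulDr : right_distributive qt_mul +%R.
Proof.
elim/qt_ind=> t; elim/qt_ind=> u; elim/qt_ind=> v.
by rewrite /GRing.add /= !qE; apply/qt_classP/q_mulDr.
Qed.

(* Nontriviality: with the order x_0 < y_0 < x_1 < y_1 < ..., the operators
   P_a f (s) = q^(s a) f (s + 1_{> a}) on functions of s : int -> int satisfy
   P_a P_b = q P_b P_a for a < b; x_i acts by P_{2i} and y_i by P_{2i+1}^-1. *)
Let V := ((int -> int) -> K).

Let P (e a : int) (f : V) : V :=
  fun s => q ^ (e * s a) * f (fun c => s c + e * (a < c)%R%:R).

Let gsgn g : int := match g with GX _ => 1 | GY _ => -1 end.
Let gidx g : int := match g with GX i => 2 * i | GY i => 2 * i + 1 end.

Let ev : term -> V -> V := fix ev t f :=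
  match t with
  | TC a => fun s => a * f s
  | TG g => P (gsgn g) (gidx g) f
  | TV g => P (- gsgn g) (gidx g) f
  | TN t => fun s => - ev t f s
  | TD t u => fun s => ev t f s + ev u f s
  | TM t u => ev t (ev u f)
  end.

Let ev_lin t (f g : V) a : ev t (fun s => a * f s + g s) =
  (fun s => a * ev t f s + ev t g s).
Proof.
elim: t f g => [b|h|h|t IHt|t IHt u IHu|t IHt u IHu] f g; apply/funext=> s /=.
- by rewrite mulrDr mulrCA.
- by rewrite /P mulrDr mulrCA.
- by rewrite /P mulrDr mulrCA.
- by rewrite IHt opprD mulrN.
- by rewrite IHt IHu mulrDr addrACA.
- by rewrite IHu IHt.
Qed.

Let evD t (f g : V) : ev t (fun s => f s + g s) =
  (fun s => ev t f s + ev t g s).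
Proof.
have := ev_lin t f g 1; under eq_fun do rewrite mul1r.
by move->; apply/funext=> s; rewrite mul1r.
Qed.

Let ev0 t : ev t (fun=> 0) = (fun=> 0).
Proof.
have := evD t (fun=> 0) (fun=> 0); under eq_fun do rewrite addr0.
move=> E; apply/funext=> s; apply: (addrI (ev t (fun=> 0) s)).
by rewrite addr0 [in RHS]E.
Qed.

Let evZ t (f : V) a : ev t (fun s => a * f s) = (fun s => a * ev t f s).
Proof.
have := ev_lin t f (fun=> 0) a; under eq_fun do rewrite addr0.
by move->; apply/funext=> s; rewrite ev0 addr0.
Qed.

Let P_comm (e e' a b c : int) (f : V) :
  c = e * e' * ((a < b)%R%:R - (b < a)%R%:R) ->
  P e a (P e' b f) = (fun s => q ^ c * P e' b (P e a f) s).
Proof.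
move=> ->; apply/funext=> s; rewrite /P !mulrA -!expfzDr ?qv_neq0 //.
congr (_ ^ _ * f _); last by apply/funext=> d; rewrite addrAC.
rewrite !mulrDr !mulrN !mulrA [e' * e]mulrC addrACA.
by rewrite [RHS]addrCA addrA; ring.
Qed.

Let P_inv (e a : int) (f : V) : P e a (P (- e) a f) = f.
Proof.
apply/funext=> s; rewrite /P ltxx mulr0 addr0 mulrA -expfzDr ?qv_neq0 //.
rewrite mulNr subrr expr0z mul1r; congr f; apply/funext=> c.
by rewrite mulNr addrK.
Qed.

Let P_lt (e e' a b c : int) (f : V) : a < b -> c = e * e' ->
  P e a (P e' b f) = (fun s => q ^ c * P e' b (P e a f) s).
Proof.
move=> ab ->; apply: P_comm.
by rewrite ab (lt_gtF ab) subr0 mulr1.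
Qed.

Let P_gt (e e' a b c : int) (f : V) : b < a -> c = - (e * e') ->
  P e a (P e' b f) = (fun s => q ^ c * P e' b (P e a f) s).
Proof.
move=> ab ->; apply: P_comm.
by rewrite ab (lt_gtF ab) sub0r mulrN1.
Qed.

Let ev_rel t u : qrel t u -> ev t = ev u.
Proof.
elim=> {t u} /=.
- by [].
- by move=> t u _ ->.
- by move=> t u v _ -> _ ->.
- by move=> t t' _ E; apply/funext=> f; rewrite E.
- by move=> t t' u u' _ E _ E'; apply/funext=> f; rewrite E E'.
- by move=> t t' u u' _ E _ E'; apply/funext=> f; rewrite E E'.
- by move=> t u v; do 2 apply/funext=> ?; rewrite addrA.
- by move=> t u; do 2 apply/funext=> ?; rewrite addrC.
- by move=> t; do 2 apply/funext=> ?; rewrite mul0r add0r.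
- by move=> t; do 2 apply/funext=> ?; rewrite mul0r addNr.
- by [].
- by move=> t; do 2 apply/funext=> ?; rewrite mul1r.
- by [].
- by move=> t u v; apply/funext=> f; rewrite evD.
- by move=> a b; do 2 apply/funext=> ?; rewrite mulrDl.
- by move=> a b; do 2 apply/funext=> ?; rewrite mulrA.
- by move=> a t; apply/funext=> f; rewrite evZ.
- by move=> g; apply/funext=> f; rewrite P_inv; apply/funext=> s; rewrite mul1r.
- move=> g; apply/funext=> f; rewrite -{2}(opprK (gsgn g)) P_inv.
  by apply/funext=> s; rewrite mul1r.
- move=> i j ij; apply/funext=> f.
  by rewrite (@P_lt _ _ _ _ 1) ?ltr_pM2l.
- move=> i j ij; apply/funext=> f.
  by rewrite (@P_lt _ _ _ _ 1) ?ltrD2r ?ltr_pM2l.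
- move=> i j ij; apply/funext=> f.
  by rewrite (@P_lt _ _ _ _ (-1)) // -?exprN1 //; lia.
- move=> i j ij; apply/funext=> f.
  by rewrite (@P_lt _ _ _ _ (-1)) //; lia.
- move=> i; apply/funext=> f.
  by rewrite (@P_lt _ _ _ _ (-1)) //; lia.
Qed.

Fact qt_1neq0 : qt_class (TC 1) != 0.
Proof.
apply/eqP=> /qt_classP/ev_rel/(congr1 (fun E => E (fun=> 1) (fun=> 0))) /=.
by rewrite mul0r mul1r => /eqP; rewrite oner_eq0.
Qed.

HB.instance Definition _ := GRing.Zmodule_isNzRing.Build T
  qt_mulA qt_mul1 qt_mulr1 qt_mulDl qt_mulDr qt_1neq0.

Fact qt_scaleA a b u : qt_scale a (qt_scale b u) = qt_scale (a * b) u.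
Proof.
elim/qt_ind: u => t; rewrite !qE; apply/qt_classP.
apply: q_trans (q_mulA _ _ _) _; apply: q_mul; last exact: q_refl.
by apply: q_sym; apply: q_constM.
Qed.
Fact qt_scale1 : left_id 1 qt_scale.
Proof. elim/qt_ind=> t; rewrite !qE; exact/qt_classP/q_mul1. Qed.
Fact qt_scaleDr : right_distributive qt_scale +%R.
Proof.
move=> a; elim/qt_ind=> t; elim/qt_ind=> u; rewrite /GRing.add /= !qE.
exact/qt_classP/q_mulDr.
Qed.
Fact qt_scaleDl u : {morph qt_scale^~ u : a b / a + b}.
Proof.
move=> a b; elim/qt_ind: u => t; rewrite !qE [in RHS]/GRing.add /= !qE.
apply/qt_classP; apply: q_trans (q_mulDl _ _ _).
by apply: q_mul; [exact: q_constD|exact: q_refl].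
Qed.

HB.instance Definition _ := GRing.Zmodule_isLmodule.Build K T
  qt_scaleA qt_scale1 qt_scaleDr qt_scaleDl.

Fact qt_scaleAl (a : K) (u v : T) : a *: (u * v) = (a *: u) * v.
Proof.
elim/qt_ind: u => t; elim/qt_ind: v => u.
rewrite /GRing.scale /GRing.mul /= !qE; exact/qt_classP/q_mulA.
Qed.

HB.instance Definition _ := GRing.Lmodule_isLalgebra.Build K T qt_scaleAl.

Fact qt_scaleAr (a : K) (u v : T) : a *: (u * v) = u * (a *: v).
Proof.
elim/qt_ind: u => t; elim/qt_ind: v => u.
rewrite /GRing.scale /GRing.mul /= !qE; apply/qt_classP.
apply: q_trans (q_mulA _ _ _) _; apply: q_trans (q_sym (q_mulA _ _ _)).
by apply: q_mul; [exact: q_central|exact: q_refl].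
Qed.

HB.instance Definition _ := GRing.Lalgebra_isAlgebra.Build K T qt_scaleAr.

HB.instance Definition _ := GRing.NzRing_hasMulInverse.Build T
  (@cl_mulVr T) (@cl_divrr T) (@cl_unitP T) (@cl_inv_out T).

Definition xgen (i : int) : T := qt_class (TG (GX i)).
Definition ygen (i : int) : T := qt_class (TG (GY i)).

Lemma xgen_unit i : xgen i \is a GRing.unit.
Proof.
apply/unitrP; exists (qt_class (TV (GX i))).
rewrite /xgen /ygen /GRing.mul /= !qE; split; apply/qt_classP.
  exact: q_Vgen.
exact: q_genV.
Qed.

Lemma ygen_unit i : ygen i \is a GRing.unit.
Proof.
apply/unitrP; exists (qt_class (TV (GY i))).
rewrite /xgen /ygen /GRing.mul /= !qE; split; apply/qt_classP.
  exact: q_Vgen.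
exact: q_genV.
Qed.

Lemma xgen_xgen (i j : int) : i < j ->
  xgen i * xgen j = q *: (xgen j * xgen i).
Proof.
move=> ij; rewrite /xgen /ygen /GRing.mul /GRing.scale /= !qE.
by apply/qt_classP; exact: q_xx.
Qed.
Lemma ygen_ygen (i j : int) : i < j ->
  ygen i * ygen j = q *: (ygen j * ygen i).
Proof.
move=> ij; rewrite /xgen /ygen /GRing.mul /GRing.scale /= !qE.
by apply/qt_classP; exact: q_yy.
Qed.
Lemma xgen_ygen (i j : int) : i < j ->
  xgen i * ygen j = q^-1 *: (ygen j * xgen i).
Proof.
move=> ij; rewrite /xgen /ygen /GRing.mul /GRing.scale /= !qE.
by apply/qt_classP; exact: q_xy.
Qed.
Lemma ygen_xgen (i j : int) : i < j ->
  ygen i * xgen j = q^-1 *: (xgen j * ygen i).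
Proof.
move=> ij; rewrite /xgen /ygen /GRing.mul /GRing.scale /= !qE.
by apply/qt_classP; exact: q_yx.
Qed.
Lemma xgen_ygen_same (i : int) :
  xgen i * ygen i = q^-1 *: (ygen i * xgen i).
Proof.
rewrite /xgen /ygen /GRing.mul /GRing.scale /= !qE.
by apply/qt_classP; exact: q_xyi.
Qed.

Lemma qt_classN t : qt_class (TN t) = - qt_class t.
Proof. by rewrite -qt_oppE. Qed.
Lemma qt_classD t u : qt_class (TD t u) = qt_class t + qt_class u.
Proof. by rewrite -qt_addE. Qed.
Lemma qt_classM t u : qt_class (TM t u) = qt_class t * qt_class u.
Proof. by rewrite -qt_mulE. Qed.
Lemma qt_classZ a t : qt_class (TM (TC a) t) = a *: qt_class t.
Proof. by rewrite -qt_scaleE. Qed.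

(* T^{1/2}, extended C(q)-linearly, as the substitution x_i -> y_i,
   y_i -> x_{i+1} in words. *)
Fixpoint tsub (h : gen -> gen) (t : term) : term :=
  match t with
  | TC a => TC a
  | TG g => TG (h g)
  | TV g => TV (h g)
  | TN t => TN (tsub h t)
  | TD t u => TD (tsub h t) (tsub h u)
  | TM t u => TM (tsub h t) (tsub h u)
  end.

Definition half (g : gen) : gen :=
  match g with GX i => GY i | GY i => GX (i + 1) end.
Definition unhalf (g : gen) : gen :=
  match g with GX i => GY (i - 1) | GY i => GX i end.

Lemma qrel_half t u : qrel t u -> qrel (tsub half t) (tsub half u).
Proof.
elim=> {t u} /=.
- by move=> t; exact: q_refl.
- by move=> t u _; exact: q_sym.
- by move=> t u v _ tu _; exact: q_trans.
- by move=> t t' _; exact: q_opp.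
- by move=> t t' u u' _ tt' _; exact: q_add.
- by move=> t t' u u' _ tt' _; exact: q_mul.
- by move=> t u v; exact: q_addA.
- by move=> t u; exact: q_addC.
- by move=> t; exact: q_add0.
- by move=> t; exact: q_addN.
- by move=> t u v; exact: q_mulA.
- by move=> t; exact: q_mul1.
- by move=> t u v; exact: q_mulDl.
- by move=> t u v; exact: q_mulDr.
- by move=> a b; exact: q_constD.
- by move=> a b; exact: q_constM.
- by move=> a t; exact: q_central.
- by move=> g; exact: q_genV.
- by move=> g; exact: q_Vgen.
- by move=> i j ij; exact: q_yy.
- by move=> i j ij; apply: q_xx; rewrite ltrD2r.
- by move=> i j ij; apply: q_yx; rewrite ltr_wpDr.
- move=> i j; rewrite -lezD1 le_eqVlt => /orP[/eqP <-|]; first exact: q_xyi.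
  exact: q_xy.
- by move=> i; apply: q_yx; rewrite ltrDl.
Qed.

Lemma qrel_unhalf t u : qrel t u -> qrel (tsub unhalf t) (tsub unhalf u).
Proof.
elim=> {t u} /=.
- by move=> t; exact: q_refl.
- by move=> t u _; exact: q_sym.
- by move=> t u v _ tu _; exact: q_trans.
- by move=> t t' _; exact: q_opp.
- by move=> t t' u u' _ tt' _; exact: q_add.
- by move=> t t' u u' _ tt' _; exact: q_mul.
- by move=> t u v; exact: q_addA.
- by move=> t u; exact: q_addC.
- by move=> t; exact: q_add0.
- by move=> t; exact: q_addN.
- by move=> t u v; exact: q_mulA.
- by move=> t; exact: q_mul1.
- by move=> t u v; exact: q_mulDl.
- by move=> t u v; exact: q_mulDr.
- by move=> a b; exact: q_constD.
- by move=> a b; exact: q_constM.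
- by move=> a t; exact: q_central.
- by move=> g; exact: q_genV.
- by move=> g; exact: q_Vgen.
- by move=> i j ij; apply: q_yy; rewrite ltrD2r.
- by move=> i j ij; exact: q_xx.
- by move=> i j ij; apply: q_yx; lia.
- move=> i j ij; have [->|ne] := eqVneq i (j - 1); first exact: q_xyi.
  by apply: q_xy; lia.
- by move=> i; apply: q_yx; lia.
Qed.

Definition Thalf (u : T) : T := qt_class (tsub half (qt_repr u)).

Lemma ThalfE t : Thalf (qt_class t) = qt_class (tsub half t).
Proof. by apply/qt_classP/qrel_half/qt_repr_class. Qed.

Fact Thalf_is_zmod_morphism : zmod_morphism Thalf.
Proof.
elim/qt_ind=> t; elim/qt_ind=> u.
by rewrite -qt_classN -qt_classD !ThalfE /= qt_classD qt_classN.
Qed.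
Fact Thalf_is_monoid_morphism : monoid_morphism Thalf.
Proof.
split; first by rewrite ThalfE.
elim/qt_ind=> t; elim/qt_ind=> u.
by rewrite -qt_classM !ThalfE /= qt_classM.
Qed.
Fact Thalf_is_scalable : scalable Thalf.
Proof.
move=> a; elim/qt_ind=> t.
by rewrite -qt_classZ !ThalfE /= qt_classZ.
Qed.

HB.instance Definition _ := GRing.isZmodMorphism.Build T T Thalf
  Thalf_is_zmod_morphism.
HB.instance Definition _ := GRing.isMonoidMorphism.Build T T Thalf
  Thalf_is_monoid_morphism.
HB.instance Definition _ := GRing.isScalable.Build K T T *:%R Thalf
  Thalf_is_scalable.

Lemma Thalf_xgen i : Thalf (xgen i) = ygen i.
Proof. by rewrite /xgen ThalfE. Qed.
Lemma Thalf_ygen i : Thalf (ygen i) = xgen (i + 1).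
Proof. by rewrite /ygen ThalfE. Qed.

Lemma Thalf_bij : bijective Thalf.
Proof.
have subK h k : cancel h k -> cancel (tsub h) (tsub k).
  move=> hK; elim=> [a|g|g|t IHt|t IHt u IHu|t IHt u IHu] /=;
    by rewrite ?hK ?IHt ?IHu.
pose S u : T := qt_class (tsub unhalf (qt_repr u)).
have SE t : S (qt_class t) = qt_class (tsub unhalf t).
  exact/qt_classP/qrel_unhalf/qt_repr_class.
exists S; elim/qt_ind=> t; rewrite !(ThalfE, SE) subK //.
  by case=> i //=; rewrite addrK.
by case=> i //=; rewrite subrK.
Qed.

End QTorus.
Arguments Thalf {F}.

(* [fcoef f n] is the coefficient of lambda^-n, and lambda^-1 is central. *)
Record fps (A : Type) := Fps { fcoef : nat -> A }.

Lemma fps_eqP A (f g : fps A) : fcoef f =1 fcoef g -> f = g.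
Proof. by case: f g => [f] [g] /= /funext ->. Qed.

HB.instance Definition _ (A : Type) := gen_eqMixin (fps A).
HB.instance Definition _ (A : Type) := gen_choiceMixin (fps A).

Section FpsRing.
Variable A : nzRingType.
Implicit Types f g h : fps A.

Definition fps_cst (a : A) : fps A := Fps (fun n => if n is 0 then a else 0).
Definition linv : fps A := Fps (fun n => (n == 1)%:R).
Definition fps_opp f := Fps (fun n => - fcoef f n).
Definition fps_add f g := Fps (fun n => fcoef f n + fcoef g n).
Definition fps_mul f g :=
  Fps (fun n => \sum_(i < n.+1) fcoef f i * fcoef g (n - i)).

Fact fps_addA : associative fps_add.
Proof. by move=> f g h; apply: fps_eqP => n /=; rewrite addrA. Qed.
Fact fps_addC : commutative fps_add.
Proof. by move=> f g; apply: fps_eqP => n /=; rewrite addrC. Qed.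
Fact fps_add0 : left_id (Fps (fun=> 0)) fps_add.
Proof. by move=> f; apply: fps_eqP => n /=; rewrite add0r. Qed.
Fact fps_addN : left_inverse (Fps (fun=> 0)) fps_opp fps_add.
Proof. by move=> f; apply: fps_eqP => n /=; rewrite addNr. Qed.

HB.instance Definition _ := GRing.isZmodule.Build (fps A)
  fps_addA fps_addC fps_add0 fps_addN.

Let trunc n f : {poly A} := \poly_(i < n.+1) fcoef f i.

Let coef_trunc n f i : (i <= n)%N -> (trunc n f)`_i = fcoef f i.
Proof. by move=> le_in; rewrite coef_poly ltnS le_in. Qed.

Let mulE f g n i : (i <= n)%N ->
  fcoef (fps_mul f g) i = (trunc n f * trunc n g)`_i.
Proof.
move=> le_in; rewrite coefM; apply: eq_bigr => j _.
rewrite !coef_trunc //; first exact: leq_trans (leq_subr _ _) le_in.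
by apply: leq_trans le_in; rewrite -ltnS.
Qed.

Fact fps_mulA : associative fps_mul.
Proof.
move=> f g h; apply: fps_eqP => n.
transitivity ((trunc n f * (trunc n g * trunc n h))`_n).
  rewrite (mulE _ _ (leqnn n)) !coefM; apply: eq_bigr => i _.
  by rewrite [(trunc n (fps_mul g h))`_ _]coef_trunc ?leq_subr //
    (mulE _ _ (leq_subr _ _)).
rewrite mulrA (mulE _ _ (leqnn n)) !coefM; apply: eq_bigr => i _.
have le_in : (i <= n)%N by rewrite -ltnS.
by rewrite [(trunc n (fps_mul f g))`_ _]coef_trunc // (mulE _ _ le_in).
Qed.

Fact fps_mul1 : left_id (fps_cst 1) fps_mul.
Proof.
move=> f; apply: fps_eqP => n /=; rewrite big_ord_recl /= mul1r subn0.
by rewrite big1 ?addr0 // => i _; rewrite mul0r.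
Qed.

Fact fps_mulr1 : right_id (fps_cst 1) fps_mul.
Proof.
move=> f; apply: fps_eqP => n /=; rewrite big_ord_recr /= subnn mulr1.
rewrite big1 ?add0r // => i _.
by have := ltn_ord i; rewrite -subn_gt0; case: (n - i)%N => // m _; rewrite mulr0.
Qed.

Fact fps_mulDl : left_distributive fps_mul +%R.
Proof.
move=> f g h; apply: fps_eqP => n /=; rewrite -big_split /=.
by apply: eq_bigr => i _; rewrite mulrDl.
Qed.
Fact fps_mulDr : right_distributive fps_mul +%R.
Proof.
move=> f g h; apply: fps_eqP => n /=; rewrite -big_split /=.
by apply: eq_bigr => i _; rewrite mulrDr.
Qed.
Fact fps_1neq0 : fps_cst 1 != 0.
Proof.
apply/eqP => /(congr1 (fun f => fcoef f 0)) /= /eqP.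
by rewrite oner_eq0.
Qed.

HB.instance Definition _ := GRing.Zmodule_isNzRing.Build (fps A)
  fps_mulA fps_mul1 fps_mulr1 fps_mulDl fps_mulDr fps_1neq0.

HB.instance Definition _ := GRing.NzRing_hasMulInverse.Build (fps A)
  (@cl_mulVr (fps A)) (@cl_divrr (fps A)) (@cl_unitP (fps A))
  (@cl_inv_out (fps A)).

(* [fps_vge k f] is v(f) >= k. *)
Definition fps_vge (k : nat) f : Prop := forall i, (i < k)%N -> fcoef f i = 0.

Definition fps_S1 f : Prop := fps_vge 1 (f - 1).

(* The (lambda^-1)-adically convergent sum over p >= 1 of a family with
   v(g p) >= p for all p: only the terms p <= n reach the coefficient of
   lambda^-n. *)
Definition fps_sum1 (g : nat -> fps A) : fps A :=
  Fps (fun n => \sum_(1 <= p < n.+1) fcoef (g p) n).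

Lemma fps_sum1_cvg (g : nat -> fps A) (m : nat) :
  (forall p, fps_vge p (g p)) ->
  fps_vge m.+1 (fps_sum1 g - \sum_(1 <= p < m.+1) g p).
Proof.
move=> gv n; rewrite ltnS => le_nm.
have sumE (r : seq nat) : fcoef (\sum_(p <- r) g p) n =
    \sum_(p <- r) fcoef (g p) n.
  by elim: r => [|p r IH]; rewrite ?big_nil ?big_cons //= IH.
rewrite /= sumE (@big_cat_nat _ _ _ n.+1 1 m.+1) //= opprD addrA subrr sub0r.
rewrite big_nat big1 ?oppr0 // => p /andP[np _]; exact: gv.
Qed.

End FpsRing.
Arguments linv {A}.

Section FpsScale.
Variables (K : pzRingType) (A : lalgType K).

Definition fps_scale (a : K) (f : fps A) : fps A :=
  Fps (fun n => a *: fcoef f n).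

Fact fps_scaleA a b f : fps_scale a (fps_scale b f) = fps_scale (a * b) f.
Proof. by apply: fps_eqP => n /=; rewrite scalerA. Qed.
Fact fps_scale1 : left_id 1 fps_scale.
Proof. by move=> f; apply: fps_eqP => n /=; rewrite scale1r. Qed.
Fact fps_scaleDr : right_distributive fps_scale +%R.
Proof. by move=> a f g; apply: fps_eqP => n /=; rewrite scalerDr. Qed.
Fact fps_scaleDl f : {morph fps_scale^~ f : a b / a + b}.
Proof. by move=> a b; apply: fps_eqP => n /=; rewrite scalerDl. Qed.

HB.instance Definition _ := GRing.Zmodule_isLmodule.Build K (fps A)
  fps_scaleA fps_scale1 fps_scaleDr fps_scaleDl.

End FpsScale.

Section QNumbers.
Variable F : fieldType.
Local Notation K := (ratq F).
Local Notation q := (qv F).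

Definition qnum (m : nat) : K := (q ^+ m - 1) / (q - 1).
Definition qfact (m : nat) : K := \prod_(1 <= k < m.+1) qnum k.

Definition qbin (m p : int) : K :=
  if p == 0 then 1
  else if (p < 0) || (Num.max 0 m < p) then 0
  else qfact (absz m) / (qfact (absz p) * qfact (absz (m - p)%R)).

(* F_q(b_1, ..., b_M), for b = [:: b_1; ...; b_M]. *)
Definition Fq (b : seq int) : K :=
  \prod_(i < (size b).-1) qbin (b`_i + b`_i.+1 - 1) b`_i.+1.

End QNumbers.

Section Statement.
Variable F : fieldType.
Local Notation K := (ratq F).
Local Notation A := (qtorus F).
Local Notation S := (fps A).
Local Notation x := (@xgen F).
Local Notation y := (@ygen F).

(* w_{2k-1} = x_k y_k and w_{2k} = y_k x_{k+1}, for k >= 1. *)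
Definition wgen (j : nat) : A :=
  if odd j then x (uphalf j)%:Z * y (uphalf j)%:Z
  else y j./2%:Z * x j./2.+1%:Z.

Definition agen (j : nat) : A := (wgen j)^-1.

(* A_n, computed with N'. The multi-index (alpha_1, ..., alpha_{2N'-2}) is the
   tuple t, with alpha_{i+1} = tnth t i; its entries are at most n because they
   sum to n. *)
Definition Acoef (N' n : nat) : A :=
  \sum_(t : (2 * N' - 2).-tuple 'I_n.+1 |
        (1 <= nth 0 (map val t) 0)%N && (\sum_(a <- t) a == n)%N)
    (qnum F n / qnum F (nth 0%N (map val t) 0)
       * Fq F [seq (val a)%:Z | a <- t])
    *: \prod_(i < 2 * N' - 2) wgen i.+1 ^- tnth t i.

Definition Bcoef (N' n : nat) : A := Thalf (Acoef N' n).

Definition psi (N' n : nat) : A := Acoef N' n + Bcoef N' n.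

Definition lnq (f : S) : S :=
  fps_sum1 (fun p => (qnum F p)^-1 *: (1 - f^-1) ^+ p).

(* cfrac [:: a_1; ...; a_m] is
   (1 - a_1 lambda^-1 (1 - a_2 lambda^-1 ( ... (1 - a_m lambda^-1)^-1
   ... )^-1)^-1)^-1. *)
Fixpoint cfrac (s : seq A) : S :=
  if s is a :: s' then (1 - fps_cst a * linv * cfrac s')^-1 else 1.

(* All the inverses in [cfrac s] exist. *)
Fixpoint cfrac_defined (s : seq A) : Prop :=
  if s is a :: s' then
    cfrac_defined s' /\ 1 - fps_cst a * linv * cfrac s' \is a GRing.unit
  else True.

Definition psi_series (N' : nat -> nat) : S :=
  fps_sum1 (fun p => (qnum F p)^-1 *: (fps_cst (psi (N' p) p) * linv ^+ p)).

End Statement.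

(* Main.v *)
From HB Require Import structures.
Require Import Defs.
From mathcomp Require Import all_boot all_order all_algebra.
From mathcomp Require Import boolp reals complex ring zify.
Set Implicit Arguments.
Unset Strict Implicit.
Unset Printing Implicit Defensive.
Import Order.TTheory GRing.Theory Num.Theory.
Local Open Scope ring_scope.

(** Write t for lambda^-1 and, for a chain a_1, a_2, ..., put
X_j = a_j t U_{j+1}, where U_j = (1 - X_j)^-1 is the continued fraction that
starts at a_j.  Since 1 - U_1^-1 = X_1, the series ln_q U_1 is the sum of the
X_1^p / [p], so everything reduces to computing the powers of X_1.

The generators satisfy a_{j+1} a_j = q a_j a_{j+1}, and a_i, a_j commute when
|i - j| >= 2 ([agen_near], [agen_far]).  Hence X_2 (a_1 t) = q (a_1 t) X_2
([cf_tail_qcomm]), and moving all the factors a_1 t of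
X_1^p = (a_1 t (1 - X_2)^-1)^p to the left turns it into
(a_1 t)^p times the product of the (1 - q^k X_2)^-1 for k < p.  By the
q-binomial theorem ([q_binomial]),

  X_1^p = (a_1 t)^p \sum_m [p + m - 1 choose m] X_2^m.

The powers of X_2 expand in the same way, and iterating produces exactly the
product of q-binomials F_q(p, m, ...) in front of the ordered monomial
a_1^p a_2^m ....  So the coefficients of X_1^p obey a recursion along the chain
([cf_tailX]), which the sum over multi-indices defining A_n obeys as well
([sum_tuple_cf_coef]).  The coefficient of t^n involves only a_1, ..., a_n,
because a zero exponent followed by a positive one has coefficient 0; this makes
the choice of N' irrelevant and gives [n] (ln_q U)_n = A_n as long as n is at
most the number of levels of U.  Finally T^{1/2} sends a_j to a_{j+1}, hence
carries the identity for U to the one for V, with B_n in place of A_n. *)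

(** * Substitution in power series and the q-binomial theorem *)

Section PowerSeries.
Variables (K : fieldType) (A : algType K).
Implicit Types (a b : A) (f g h X Y : fps A) (c : nat -> K).

Fact fps_scalerAl (k : K) f g : k *: (f * g) = (k *: f) * g.
Proof.
apply: fps_eqP => n /=; rewrite scaler_sumr.
by apply: eq_bigr => i _; rewrite scalerAl.
Qed.

HB.instance Definition _ := GRing.Lmodule_isLalgebra.Build K (fps A)
  fps_scalerAl.

Fact fps_scalerAr (k : K) f g : k *: (f * g) = f * (k *: g).
Proof.
apply: fps_eqP => n /=; rewrite scaler_sumr.
by apply: eq_bigr => i _; rewrite scalerAr.
Qed.

HB.instance Definition _ := GRing.Lalgebra_isAlgebra.Build K (fps A)
  fps_scalerAr.

Lemma fcoefDB f g h n :
  fcoef (f + g - h) n = fcoef f n + fcoef g n - fcoef h n.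
Proof. by []. Qed.

Lemma fps_sum1_coef0 (g : nat -> fps A) : fcoef (fps_sum1 g) 0 = 0.
Proof. exact: big_geq. Qed.

Lemma fcoef_sum I (r : seq I) (P : pred I) (F : I -> fps A) n :
  fcoef (\sum_(i <- r | P i) F i) n = \sum_(i <- r | P i) fcoef (F i) n.
Proof. exact: (big_morph (fun f => fcoef f n)). Qed.

Lemma eq_fcoefMl f f' g n : (forall i, (i <= n)%N -> fcoef f i = fcoef f' i) ->
  fcoef (f * g) n = fcoef (f' * g) n.
Proof. by move=> E; apply: eq_bigr => i _; rewrite E // -ltnS. Qed.

Lemma eq_fcoefMr f g g' n : (forall i, (i <= n)%N -> fcoef g i = fcoef g' i) ->
  fcoef (f * g) n = fcoef (f * g') n.
Proof. by move=> E; apply: eq_bigr => i _; rewrite E // leq_subr. Qed.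

Lemma fps_vgeM k l f g : fps_vge k f -> fps_vge l g -> fps_vge (k + l) (f * g).
Proof.
move=> fk gl n lt_n; apply: big1 => i _.
have [ik|ki] := ltnP i k; first by rewrite fk ?mul0r.
by rewrite gl ?mulr0 //; have := ltn_ord i; lia.
Qed.

Lemma fps_vgeX m X : fps_vge 1 X -> fps_vge m (X ^+ m).
Proof.
by move=> X1; elim: m => [|m IH] //; rewrite exprS -add1n; apply: fps_vgeM.
Qed.

Lemma linvE f n : fcoef (linv * f) n = if n is n'.+1 then fcoef f n' else 0.
Proof.
case: n => [|n] /=; first by rewrite big_ord_recl big_ord0 mul0r addr0.
rewrite !big_ord_recl /= mul0r mul1r add0r subSS subn0 big1 ?addr0 // => i _.
by rewrite mul0r.
Qed.

Lemma fps_cstE a f n : fcoef (fps_cst a * f) n = a * fcoef f n.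
Proof.
by rewrite /= big_ord_recl /= subn0 big1 ?addr0 // => i _; rewrite mul0r.
Qed.

Lemma linv_central f : linv * f = f * linv.
Proof.
apply: fps_eqP => n; rewrite linvE /=.
case: n => [|n]; first by rewrite big_ord_recl big_ord0 mulr0 addr0.
rewrite !big_ord_recr /= subnn mulr0 addr0 subSn // subnn mulr1.
rewrite big1 ?add0r // => i _.
suff -> : (n.+1 - i == 1)%N = false by rewrite mulr0.
by have := ltn_ord i; lia.
Qed.

Lemma fps_cstM a b : fps_cst (a * b) = fps_cst a * fps_cst b.
Proof. by apply: fps_eqP => -[|n]; rewrite fps_cstE //= mulr0. Qed.

Lemma fps_cstZ (k : K) a : fps_cst (k *: a) = k *: fps_cst a.
Proof. by apply: fps_eqP => -[|n] //=; rewrite scaler0. Qed.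

Lemma cst_linvE p a f n : fcoef ((fps_cst a * linv) ^+ p * f) n =
  if (p <= n)%N then a ^+ p * fcoef f (n - p) else 0.
Proof.
elim: p n => [|p IH] n; first by rewrite subn0 expr0 !mul1r.
rewrite exprS -!mulrA fps_cstE linvE.
case: n => [|n]; first by rewrite mulr0.
by rewrite IH ltnS; case: ifP => _; rewrite ?mulr0 // mulrA -exprS.
Qed.

Lemma vge_cst_linv a f : fps_vge 1 (fps_cst a * linv * f).
Proof. by case=> // _; rewrite -mulrA fps_cstE linvE mulr0. Qed.

(** The series \sum_m c_m X^m when v(X) >= 1: then X^m has no coefficient below
m, so stopping the sum at m = n is harmless in degree n. *)
Definition fps_subst c X : fps A :=
  Fps (fun n => \sum_(m < n.+1) c m *: fcoef (X ^+ m) n).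

Lemma fps_subst_trunc c X M n : fps_vge 1 X -> (n <= M)%N ->
  fcoef (fps_subst c X) n = fcoef (\sum_(m < M.+1) c m *: X ^+ m) n.
Proof.
move=> X1 le_nM; rewrite fcoef_sum /=.
rewrite (big_ord_widen M.+1 (fun m => c m *: fcoef (X ^+ m) n)) // big_mkcond.
apply: eq_bigr => m _; case: ifP => // /negbT; rewrite -leqNgt => lt_nm.
by rewrite /= (fps_vgeX X1) ?scaler0.
Qed.

Lemma eq_fps_subst c c' X : c =1 c' -> fps_subst c X = fps_subst c' X.
Proof. by move=> E; apply: fps_eqP => n; apply: eq_bigr => m _; rewrite E. Qed.

Lemma fps_substB c c' X :
  fps_subst c X - fps_subst c' X = fps_subst (fun m => c m - c' m) X.
Proof.
apply: fps_eqP => n /=; rewrite -sumrB.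
by apply: eq_bigr => m _; rewrite scalerBl.
Qed.

Lemma fps_subst_delta X : fps_subst (fun m => (m == 0)%:R) X = 1.
Proof.
apply: fps_eqP => n /=; rewrite big_ord_recl scale1r expr0 big1 ?addr0 //.
by move=> i _; rewrite scale0r.
Qed.

Definition shift c m := if m is m'.+1 then c m' else 0.

Lemma fps_substX c X : fps_vge 1 X -> fps_subst c X * X = fps_subst (shift c) X.
Proof.
move=> X1; apply: fps_eqP => n; rewrite (@fps_subst_trunc (shift c) X n.+1) //.
rewrite big_ord_recl [shift c ord0 *: _]scale0r add0r.
rewrite (@eq_fcoefMl _ (\sum_(m < n.+1) c m *: X ^+ m)); last first.
  by move=> i; exact: fps_subst_trunc.
rewrite mulr_suml; congr (fcoef _ n); apply: eq_bigr => m _.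
by rewrite -scalerAl -exprSr.
Qed.

(** Passing Y to the left of X^m costs the factor k^m. *)
Lemma fps_subst_comm c X Y (k : K) : fps_vge 1 X -> X * Y = k *: (Y * X) ->
  fps_subst c X * Y = Y * fps_subst (fun m => k ^+ m * c m) X.
Proof.
move=> X1 XY; apply: fps_eqP => n.
rewrite (@eq_fcoefMl _ (\sum_(m < n.+1) c m *: X ^+ m)); last first.
  by move=> i; exact: fps_subst_trunc.
rewrite (@eq_fcoefMr Y _ (\sum_(m < n.+1) (k ^+ m * c m) *: X ^+ m)); last first.
  by move=> i; apply: (fps_subst_trunc (fun m => k ^+ m * c m)).
rewrite mulr_suml mulr_sumr; congr (fcoef _ n); apply: eq_bigr => -[m _] /= _.
rewrite -scalerAl -scalerAr mulrC -scalerA; congr (_ *: _).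
elim: m => [|m IH]; first by rewrite !expr0 mul1r mulr1 scale1r.
by rewrite exprSr -mulrA XY -scalerAr mulrA IH -scalerAl scalerA -exprS mulrA.
Qed.

Lemma geometric_series X : fps_vge 1 X ->
  (1 - X) * fps_subst (fun=> 1) X = 1 /\ fps_subst (fun=> 1) X * (1 - X) = 1.
Proof.
move=> X1; have R : fps_subst (fun=> 1) X * (1 - X) = 1.
  rewrite mulrBr mulr1 fps_substX // fps_substB -(fps_subst_delta X).
  by apply: eq_fps_subst => -[|m] /=; rewrite ?subr0 ?subrr.
split=> //; rewrite -[RHS]R mulrBl mulrBr mul1r mulr1; congr (_ - _).
rewrite (@fps_subst_comm _ _ _ 1) ?scale1r //; congr (_ * _).
by apply: eq_fps_subst => m; rewrite expr1n mul1r.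
Qed.

Lemma unit_1B X : fps_vge 1 X -> 1 - X \is a GRing.unit.
Proof.
by case/geometric_series => R L; apply/unitrP; exists (fps_subst (fun=> 1) X).
Qed.

Lemma inv_1B X : fps_vge 1 X -> (1 - X)^-1 = fps_subst (fun=> 1) X.
Proof.
move=> X1; have [R _] := geometric_series X1.
by apply: (mulrI (unit_1B X1)); rewrite R mulrV ?unit_1B.
Qed.

(** Here Q p m is [p + m - 1 choose m]; the three conditions on Q are its
boundary values and the Pascal rule.  By induction on p: appending a factor
Y (1 - X)^-1 and moving this Y to the left replaces Q p m by k^m Q p m, and by
the Pascal rule multiplying the series of Q p.+1 by 1 - X gives the series of
k^m Q p m. *)
Lemma q_binomial (k : K) (Q : nat -> nat -> K) X Y :
  (forall p, Q p 0 = 1) -> (forall m, Q 0 m.+1 = 0) ->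
  (forall p m, Q p.+1 m.+1 = Q p.+1 m + k ^+ m.+1 * Q p m.+1) ->
  fps_vge 1 X -> X * Y = k *: (Y * X) ->
  forall p, (Y * (1 - X)^-1) ^+ p = Y ^+ p * fps_subst (Q p) X.
Proof.
move=> Q0 Q0S QS X1 XY; elim=> [|p IH].
  rewrite !expr0 mul1r -(fps_subst_delta X).
  by apply: eq_fps_subst => -[|m]; rewrite ?Q0 ?Q0S.
rewrite exprSr IH mulrA -(mulrA (Y ^+ p)) (fps_subst_comm _ X1 XY) mulrA -exprSr.
rewrite -mulrA; congr (_ * _); apply: (mulIr (unit_1B X1)).
rewrite -mulrA mulVr ?unit_1B // mulr1 mulrBr mulr1 fps_substX // fps_substB.
apply: eq_fps_subst => -[|m] /=; first by rewrite subr0 !Q0 mulr1.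
by rewrite QS addrAC subrr add0r.
Qed.

End PowerSeries.

(** * Gaussian binomials *)

Section QBinomials.
Variable F : fieldType.
Local Notation K := (ratq F).
Local Notation q := (qv F).

Lemma qvX_neq1 n : q ^+ n.+1 - 1 != 0.
Proof.
rewrite /qv -tofracXn -tofrac1 -tofracB tofrac_eq0 -size_poly_eq0.
by rewrite size_XnsubC.
Qed.

Lemma qnum_neq0 n : qnum F n.+1 != 0.
Proof.
by rewrite mulf_neq0 ?invr_eq0 ?qvX_neq1 //; have := qvX_neq1 0; rewrite expr1.
Qed.

Lemma qnumD m n : qnum F (m + n) = qnum F m + q ^+ m * qnum F n.
Proof. by rewrite /qnum exprD; ring. Qed.

Lemma qfactS n : qfact F n.+1 = qfact F n * qnum F n.+1.
Proof. by rewrite /qfact big_nat_recr. Qed.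

Lemma qfact_neq0 n : qfact F n != 0.
Proof.
elim: n => [|n IH]; first by rewrite /qfact big_geq ?oner_neq0.
by rewrite qfactS mulf_neq0 ?qnum_neq0.
Qed.

(** The number of multisets of size m on p letters, q-counted; it is the factor
that two consecutive entries p, m contribute to F_q. *)
Definition qmbin (p m : nat) : K := qbin F (p%:Z + m%:Z - 1) m%:Z.

Lemma qmbin0 p : qmbin p 0 = 1.
Proof. by []. Qed.

Lemma qmbin0S m : qmbin 0 m.+1 = 0.
Proof. by rewrite /qmbin /qbin /= ifT //; lia. Qed.

Lemma qmbinE p m : qmbin p.+1 m = qfact F (p + m) / (qfact F m * qfact F p).
Proof.
rewrite /qmbin /qbin; case: m => [|m] /=.
  by rewrite addn0 [qfact F 0]big_geq // mul1r divff ?qfact_neq0.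
rewrite ifF; last by lia.
congr (qfact F _ / (_ * qfact F _)); lia.
Qed.

(** The Pascal rule, from [p + m] = [m] + q^m [p]. *)
Lemma qmbinS p m : qmbin p.+1 m.+1 = qmbin p.+1 m + q ^+ m.+1 * qmbin p m.+1.
Proof.
case: p => [|p].
  by rewrite qmbin0S mulr0 addr0 !qmbinE !add0n [qfact F 0]big_geq // !mulr1
    !divff ?qfact_neq0.
rewrite !qmbinE (addnS p.+1) (addSnnS p) (qfactS (p + m.+1)) !(qfactS m, qfactS p).
have -> : (p + m.+1).+1 = (m.+1 + p.+1)%N by lia.
rewrite qnumD.
(* The q-integers x, y are [m + 1], [p + 1], and w is q ^+ m.+1. *)
have cancel (L : fieldType) (t u v x y w : L) :
    u != 0 -> v != 0 -> x != 0 -> y != 0 ->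
    t * (x + w * y) / (u * x * (v * y)) =
    t / (u * (v * y)) + w * (t / (u * x * v)).
  by move=> *; field; apply/and4P.
by apply: cancel; rewrite ?qfact_neq0 ?qnum_neq0.
Qed.

End QBinomials.

(** * Powers of the tail of a continued fraction *)

Section ContinuedFraction.
Variable F : fieldType.
Local Notation K := (ratq F).
Local Notation q := (qv F).
Local Notation A := (qtorus F).
Implicit Types (a b : A) (s r : seq A).

(** The empty chain gets 0, so that it fits the uniform formula [cfracE] and can
serve as the base case below. *)
Definition cf_tail s : fps A :=
  if s is a :: s' then fps_cst a * linv * cfrac s' else 0.

Lemma cfracE s : cfrac s = (1 - cf_tail s)^-1.
Proof. by case: s => [|a s] //=; rewrite subr0 invr1. Qed.

Lemma cf_tail_vge s : fps_vge 1 (cf_tail s).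
Proof. by case: s => [|a s] //; apply: vge_cst_linv. Qed.

Lemma cfrac_is_defined s : cfrac_defined s.
Proof.
by elim: s => //= a s IH; split=> //; apply: (unit_1B (@cf_tail_vge (a :: s))).
Qed.

Lemma cfrac_S1 s : fps_S1 (cfrac s).
Proof.
case=> // _; rewrite cfracE inv_1B; last exact: cf_tail_vge.
by rewrite /= big_ord_recl big_ord0 scale1r addr0 subrr.
Qed.

Lemma sub1_cfracV s : 1 - (cfrac s)^-1 = cf_tail s.
Proof. by rewrite cfracE invrK subKr. Qed.

(** The pattern of the chains of a_j: it lets the first entry move through the
continued fraction of the others at the cost of powers of q. *)
Fixpoint qchain s : Prop :=
  if s is a :: s' then
    (if s' is b :: r then
       b * a = q *: (a * b) /\ (forall c, c \in r -> c * a = a * c)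
     else True) /\ qchain s'
  else True.

Lemma cfrac_comm a s : (forall c, c \in s -> c * a = a * c) ->
  cfrac s * fps_cst a = fps_cst a * cfrac s.
Proof.
elim: s => [|b s IH] com /=; first by rewrite mul1r mulr1.
apply/commr_sym/commrV/commrB; first exact: commr1.
rewrite /GRing.comm -!mulrA IH; last by move=> c cs; rewrite com // inE cs orbT.
by rewrite !mulrA -!fps_cstM -com ?mem_head // fps_cstM -!(mulrA (fps_cst b))
  linv_central.
Qed.

(** In the tail b t cfrac r of the chain, only b fails to commute with a. *)
Lemma cf_tail_qcomm a s : qchain (a :: s) ->
  cf_tail s * (fps_cst a * linv) = q *: (fps_cst a * linv * cf_tail s).
Proof.
case: s => [|b s] /=; first by rewrite mul0r mulr0 scaler0.
case=> -[ba com] _.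
rewrite -!mulrA (linv_central (cfrac s * _)) (linv_central (fps_cst b * _)).
rewrite (linv_central (cfrac s)) -!mulrA (mulrA (cfrac s)) (cfrac_comm com).
by rewrite !mulrA -!fps_cstM ba fps_cstZ -!scalerAl.
Qed.

(** The coefficient of lambda^-n in X^p, where X is the tail of the continued
fraction of s: unfolded, the sum of F_q(p, m_2, ...) a_1^p a_2^{m_2} ... over
all p + m_2 + ... = n. *)
Fixpoint cf_coef s (p n : nat) : A :=
  if s is a :: s' then
    if (p <= n)%N then
      a ^+ p * (\sum_(m < (n - p).+1) qmbin F p m *: cf_coef s' m (n - p))
    else 0
  else ((p == 0) && (n == 0))%:R.

(** The q-binomial theorem, applied once per level of the continued fraction. *)
Lemma cf_tailX s p n : qchain s -> fcoef (cf_tail s ^+ p) n = cf_coef s p n.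
Proof.
elim: s p n => [|a s IH] p n chain.
  by rewrite expr0n; case: p => [|p] //=; case: n.
have [_ chain'] := chain.
rewrite [cf_tail _]/= cfracE (q_binomial (@qmbin0 F) (@qmbin0S F) (@qmbinS F)
  (@cf_tail_vge s) (cf_tail_qcomm chain)).
rewrite cst_linvE /=; case: ifP => // _; congr (_ * _).
by apply: eq_bigr => m _; rewrite IH.
Qed.

Lemma lnq_cfrac s n : qchain s ->
  fcoef (lnq (cfrac s)) n = \sum_(1 <= p < n.+1) (qnum F p)^-1 *: cf_coef s p n.
Proof.
by move=> chain; apply: eq_bigr => p _; rewrite sub1_cfracV /= cf_tailX.
Qed.

Lemma sum_qmbin0 (G : nat -> A) n :
  \sum_(m < n.+1) qmbin F 0 m *: G m = G 0.
Proof.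
rewrite big_ord_recl qmbin0 scale1r big1 ?addr0 // => i _.
by rewrite qmbin0S scale0r.
Qed.

Lemma cf_coef0 s n : cf_coef s 0 n = (n == 0)%:R.
Proof.
elim: s => //= a s IH; rewrite subn0 expr0 mul1r.
by rewrite (sum_qmbin0 (cf_coef s ^~ n)).
Qed.

(** A nonzero exponent uses up at least one unit of n, and after a zero exponent
only zero exponents contribute, so entries beyond the n-th are never reached. *)
Lemma cf_coef_cat s r p n : (n <= size s)%N ->
  cf_coef (s ++ r) p n = cf_coef s p n.
Proof.
case: p => [|p]; first by rewrite !cf_coef0.
elim: s p n => [|a s IH] p n.
  by case: n => // _; case: r.
move=> /= le_ns; case: ifP => // le_pn; congr (_ * _); apply: eq_bigr.
move=> [[|m] _] _ /=; first by rewrite !cf_coef0.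
by rewrite IH //; lia.
Qed.

Lemma cf_coef_iota (a : nat -> A) j L p n : (n <= L)%N ->
  cf_coef [seq a i | i <- iota j L] p n = cf_coef [seq a i | i <- iota j n] p n.
Proof.
move=> le_nL; rewrite -(subnKC le_nL) iotaD map_cat cf_coef_cat //.
by rewrite size_map size_iota.
Qed.

Lemma Thalf_cf_coef s p n :
  Thalf (cf_coef s p n) = cf_coef [seq Thalf a | a <- s] p n.
Proof.
elim: s p n => [|a s IH] p n /=; first by rewrite rmorph_nat.
case: ifP => _; last by rewrite rmorph0.
rewrite rmorphM rmorphXn rmorph_sum; congr (_ * _).
by apply: eq_bigr => m _; rewrite /= linearZ /= IH.
Qed.

(** The default 0 for the head of an empty t is harmless: [p - 1 choose 0] = 1. *)
Lemma Fq_cons (p : nat) (t : seq nat) :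
  Fq F (map Posz (p :: t)) = qmbin F p (nth 0 t 0) * Fq F (map Posz t).
Proof.
rewrite /Fq; case: t => [|m t]; first by rewrite /= !big_ord0 qmbin0 mulr1.
by rewrite [LHS]big_ord_recl.
Qed.

Lemma big_tuple_cons (T : finType) (R : nmodType) L (P : pred (seq T))
    (G : T -> L.-tuple T -> R) (G' : L.+1.-tuple T -> R) :
    (forall i (t : L.-tuple T), G' [tuple of i :: t] = G i t) ->
  \sum_(t : L.+1.-tuple T | P t) G' t =
  \sum_i \sum_(t : L.-tuple T | P (i :: t)) G i t.
Proof.
move=> GE; rewrite pair_big_dep /=.
rewrite (reindex (fun u : T * L.-tuple T => [tuple of u.1 :: u.2])) /=.
  by apply: eq_bigr => -[i t] _; rewrite GE.
exists (fun t => (thead t, [tuple of behead t])) => [[i t] _|t _] /=.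
  by congr (_, _); apply: val_inj.
by rewrite [RHS]tuple_eta; apply: val_inj.
Qed.

(** Splitting off the first entry of the multi-index reproduces the recursion of
[cf_coef].  The weight g of the first entry is arbitrary because the induction
applies the statement again with the q-binomial linking two consecutive entries
as weight; the bound B on the entries is fixed while n decreases. *)
Lemma sum_tuple_cf_coef (a : nat -> A) (g : nat -> K) B L j n : (n < B)%N ->
  \sum_(t : L.-tuple 'I_B | (\sum_(i <- t) i == n)%N)
     (g (nth 0%N (map val t) 0) * Fq F [seq (val i)%:Z | i <- t])
       *: \prod_(i < L) a (j + i)%N ^+ tnth t i =
  \sum_(p < n.+1) g p *: cf_coef [seq a i | i <- iota j L] p n.
Proof.
elim: L j n g => [|L IH] j n g lt_nB.
  rewrite big_ord_recl [X in _ = _ + X]big1 => [|p _]; last exact: scaler0.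
  rewrite addr0 (eq_bigl (fun=> n == 0)) => [|t]; last first.
    by rewrite tuple0 big_nil eq_sym.
  case: (n =P 0) => [->|/eqP/negbTE nn0] /=; last first.
    by rewrite big_pred0_eq nn0 mulr0n scaler0.
  rewrite (big_pred1 [tuple]) => [|t]; last by apply/esym/eqP/tuple0.
  by rewrite big_ord0 /Fq big_ord0 mulr1.
rewrite (@big_tuple_cons _ _ _ (fun t => (\sum_(i <- t) val i == n)%N)
  (fun (i : 'I_B) t => g i *: (a j ^+ i *
     ((qmbin F i (nth 0%N (map val t) 0) * Fq F [seq (val i)%:Z | i <- t])
       *: \prod_(i < L) a (j.+1 + i)%N ^+ tnth t i)))); last first.
  move=> i t; rewrite big_ord_recl addn0 (tnth_nth i) /=.
  rewrite -scalerAr scalerA; congr (_ * _ *: (_ * _)).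
    by have := Fq_cons i (map val t); rewrite /= -map_comp.
  by apply: eq_bigr => k _; rewrite !(tnth_nth i) addSnnS.
rewrite (big_ord_widen B
  (fun p => g p *: cf_coef [seq a i | i <- iota j L.+1] p n)) //.
rewrite [RHS]big_mkcond; apply: eq_bigr => i _; rewrite ltnS.
under eq_bigl do rewrite big_cons.
case: leqP => [le_in|lt_ni]; last first.
  by rewrite big_pred0 // => t; rewrite gtn_eqF // ltn_addr.
rewrite -scaler_sumr -mulr_sumr /= le_in.
rewrite -(IH j.+1 (n - i)%N (qmbin F i)); last by lia.
congr (_ *: (_ * _)); apply: eq_bigl => t.
by rewrite -[RHS](eqn_add2l i) subnKC.
Qed.

End ContinuedFraction.

(** * The generators of the quantum torus *)

Section Generators.
Variable F : fieldType.
Local Notation K := (ratq F).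
Local Notation q := (qv F).
Local Notation A := (qtorus F).
Implicit Types (u v w : A) (c d : K).

Lemma qcommMl c d u v w : u * w = c *: (w * u) -> v * w = d *: (w * v) ->
  u * v * w = (c * d) *: (w * (u * v)).
Proof.
move=> uw vw.
by rewrite -mulrA vw -scalerAr (mulrA u) uw -scalerAl scalerA mulrC mulrA.
Qed.

Lemma qcommMr c d u v w : u * v = c *: (v * u) -> u * w = d *: (w * u) ->
  u * (v * w) = (c * d) *: (v * w * u).
Proof.
move=> uv uw.
by rewrite mulrA uv -scalerAl -(mulrA v u) uw -scalerAr scalerA mulrA.
Qed.

Lemma qcommV c u v : v \is a GRing.unit -> u * v = c *: (v * u) ->
  v^-1 * u = c *: (u * v^-1).
Proof.
move=> vU uv; apply: (mulrI vU); apply: (mulIr vU).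
by rewrite mulVKr // uv -scalerAr -scalerAl -!mulrA mulVr // mulr1.
Qed.

(** The generators in the order x_0, y_0, x_1, y_1, ..., in which T^{1/2} is the
shift by one and the q-commutation exponent depends only on parities. *)
Definition zgen (m : nat) : A :=
  if odd m then ygen F m./2%:Z else xgen F m./2%:Z.

Lemma zgen_unit m : zgen m \is a GRing.unit.
Proof. by rewrite /zgen; case: ifP; rewrite ?xgen_unit ?ygen_unit. Qed.

Lemma zgen_comm m n : (m < n)%N -> zgen m * zgen n =
  (if odd (m + n) then q^-1 else q) *: (zgen n * zgen m).
Proof.
move=> lt_mn; rewrite oddD /zgen.
case om: (odd m); case on: (odd n) => /=.
- by rewrite ygen_ygen //; lia.
- by rewrite ygen_xgen //; lia.
- have [->|ne] := eqVneq n./2 m./2; first exact: xgen_ygen_same.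
  by rewrite xgen_ygen //; lia.
- by rewrite xgen_xgen //; lia.
Qed.

Lemma Thalf_zgen m : Thalf (zgen m) = zgen m.+1.
Proof.
rewrite /zgen /= uphalf_half; case: (odd m) => /=.
  by rewrite Thalf_ygen addrC.
by rewrite Thalf_xgen.
Qed.

Lemma wgenE j : wgen F j = zgen j.+1 * zgen j.+2.
Proof. by rewrite /wgen /zgen /= negbK uphalf_half; case: (odd j). Qed.

Lemma wgen_unit j : wgen F j \is a GRing.unit.
Proof. by rewrite wgenE unitrMl ?zgen_unit. Qed.

(** The generator z_{j+2} is shared; the pairs (j+1, j+2), (j+1, j+3), (j+2, j+3)
contribute the exponents -1, 1 and -1 of q. *)
Lemma wgen_near j : wgen F j * wgen F j.+1 = q^-1 *: (wgen F j.+1 * wgen F j).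
Proof.
have zz m : zgen m * zgen m = 1 *: (zgen m * zgen m) by rewrite scale1r.
have := @zgen_comm j.+1 j.+2 (leqnn _).
have := @zgen_comm j.+2 j.+3 (leqnn _).
have := @zgen_comm j.+1 j.+3 (leqnSn _).
rewrite !(addSn, addnS) /= !negbK addnn odd_double /= => c13 c23 c12.
rewrite !wgenE (qcommMl (qcommMr c12 c13) (qcommMr (zz _) c23)).
by rewrite mul1r mulVf ?qv_neq0 ?mul1r.
Qed.

(** Two exponents are 1 and two are -1, so they cancel. *)
Lemma wgen_far i j : (i.+1 < j)%N -> wgen F i * wgen F j = wgen F j * wgen F i.
Proof.
move=> ij; rewrite !wgenE.
have C m n : (m < n)%N -> _ := @zgen_comm m n.
rewrite (qcommMl (qcommMr (C i.+1 j.+1 _) (C i.+1 j.+2 _))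
  (qcommMr (C i.+2 j.+1 _) (C i.+2 j.+2 _))); try lia.
rewrite !(addSn, addnS) /= !negbK.
by case: (odd _) => /=; rewrite ?(mulVf, mulfV) ?qv_neq0 ?mul1r ?scale1r.
Qed.

Lemma agen_near j : agen F j.+1 * agen F j = q *: (agen F j * agen F j.+1).
Proof.
have := qcommV (wgen_unit _) (qcommV (wgen_unit _) (wgen_near j)).
by rewrite /agen => ->; rewrite scalerA mulfV ?qv_neq0 // scale1r.
Qed.

Lemma agen_far i j : (i.+1 < j)%N -> agen F j * agen F i = agen F i * agen F j.
Proof.
move=> ij; have := wgen_far ij; rewrite -[RHS]scale1r => E.
have := qcommV (wgen_unit _) (qcommV (wgen_unit _) E).
by rewrite scale1r.
Qed.

Lemma qchain_agen j L : qchain [seq agen F i | i <- iota j L].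
Proof.
elim: L j => //= L IH j; split; last exact: IH.
case: L {IH} => //= L; split; first exact: agen_near.
by move=> c /mapP[k]; rewrite mem_iota => /andP[lt_jk _] ->; apply: agen_far.
Qed.

Lemma Thalf_agen j : Thalf (agen F j) = agen F j.+1.
Proof.
by rewrite /agen rmorphV ?wgen_unit // !wgenE rmorphM /= !Thalf_zgen.
Qed.

(** The weight of the first entry p is [n] / [p], or 0 at the excluded p = 0. *)
Lemma Acoef_cf_coef N' n : (n <= 2 * N' - 2)%N ->
  Acoef F N' n = qnum F n *: \sum_(1 <= p < n.+1)
    (qnum F p)^-1 *: cf_coef [seq agen F i | i <- iota 1 n] p n.
Proof.
move=> le_nL.
pose g p : K := if p is 0 then 0 else qnum F n / qnum F p.
transitivity (\sum_(p < n.+1)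
  g p *: cf_coef [seq agen F i | i <- iota 1 (2 * N' - 2)] p n); last first.
  rewrite big_ord_recl scale0r add0r scaler_sumr big_add1 big_mkord.
  by apply: eq_bigr => p _; rewrite cf_coef_iota // scalerA.
rewrite -(sum_tuple_cf_coef _ _ _ _ (ltnSn n)) /Acoef big_mkcondl.
apply: eq_bigr => t _; case: (nth _ _ _) => [|p] /=.
  by rewrite mul0r scale0r.
by congr (_ *: _); apply: eq_bigr => i _; rewrite exprVn.
Qed.

(** The number j of applications of T^{1/2} is the shift of the chain: U is the
case j = 0 and V the case j = 1. *)
Lemma lnq_cfrac_agen N' j L n : (0 < n <= L)%N -> (n <= 2 * N' - 2)%N ->
  fcoef (lnq (cfrac [seq agen F i | i <- iota j.+1 L])) n =
  (qnum F n)^-1 *: iter j Thalf (Acoef F N' n).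
Proof.
move=> /andP[n0 le_nL] le_nN.
rewrite lnq_cfrac; last exact: qchain_agen.
under eq_bigr do rewrite cf_coef_iota //.
elim: j => [|j IH] /=.
  by rewrite Acoef_cf_coef // scalerA mulVf ?scale1r // -(prednK n0) qnum_neq0.
rewrite -linearZ -IH linear_sum /=; apply: eq_bigr => p _.
rewrite linearZ /= Thalf_cf_coef; congr (_ *: cf_coef _ _ _).
rewrite -map_comp (iotaDl 1 j.+1) -map_comp.
by apply: eq_map => i /=; rewrite Thalf_agen.
Qed.

Lemma psi_seriesE (N' : nat -> nat) n : (0 < n)%N ->
  fcoef (psi_series F N') n = (qnum F n)^-1 *: psi F (N' n) n.
Proof.
move=> n0; rewrite /psi_series.
have monoE (p : nat) : fcoef (fps_cst (psi F (N' p) p) * linv ^+ p : fps A) n =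
    if p == n then psi F (N' p) p else 0.
  rewrite fps_cstE -[linv]mul1r.
  have := @cst_linvE K A p 1 1 n; rewrite mulr1 => ->.
  rewrite expr1n mul1r /=; case: (ltngtP p n) => [lt|gt|->].
  - by rewrite -(subnSK lt) mulr0.
  - by rewrite mulr0.
  - by rewrite subnn mulr1.
have termE (p : nat) :
    fcoef ((qnum F p)^-1 *: (fps_cst (psi F (N' p) p) * linv ^+ p) : fps A) n =
    if p == n then (qnum F p)^-1 *: psi F (N' p) p else 0.
  by rewrite /= [X in _ *: X]monoE; case: eqP; rewrite ?scaler0.
apply: etrans (eq_bigr _ (fun p _ => termE p)) _.
rewrite -big_mkcond (big_nat1_eq _ (fun p => _ *: psi F (N' p) p)).
by rewrite n0 ltnSn.
Qed.

End Generators.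

Theorem mainTheorem2 (R : realType) (N : nat) (hN : (2 <= N)%N)
    (N' : nat -> nat)
    (hN' : forall n, (1 <= n)%N -> (n <= 2 * (N' n - 1))%N) :
  let sU := [seq agen (complex R) j | j <- iota 1 (2 * N - 2)] in
  let sV := [seq agen (complex R) j | j <- iota 2 (2 * N - 2)] in
  let U := cfrac sU in
  let V := cfrac sV in
  [/\ cfrac_defined sU, cfrac_defined sV, fps_S1 U, fps_S1 V &
      fps_vge (2 * N - 1) (lnq U + lnq V - psi_series (complex R) N')].
Proof.
move=> sU sV U V; split; [exact: cfrac_is_defined|exact: cfrac_is_defined|
  exact: cfrac_S1|exact: cfrac_S1|].
move=> n lt_n; apply: etrans (fcoefDB (lnq U) (lnq V) _ n) _.
have coef_eq (c u v w : qtorus (complex R)) (k : ratq (complex R)) :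
  u = k *: c -> v = k *: Thalf c -> w = k *: (c + Thalf c) -> u + v - w = 0.
  by move=> -> -> ->; rewrite -scalerDr subrr.
case: n lt_n => [|n] lt_n.
  (* All three series start in degree 1. *)
  by apply: (coef_eq 0 _ _ _ 0); rewrite scale0r; apply: fps_sum1_coef0.
have bN : (n.+1 <= 2 * N' n.+1 - 2)%N by have := hN' n.+1 isT; lia.
have bL : (0 < n.+1 <= 2 * N - 2)%N by lia.
apply: coef_eq; [exact: (lnq_cfrac_agen (complex R) 0 bL bN)|
  exact: (lnq_cfrac_agen (complex R) 1 bL bN)|exact: psi_seriesE].
Qed.
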